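(* Let $p$ be a prime, let $k$ be a field of characteristic $p$, let $r$ be a positive integer, and let $\lambda,\mu$ be partitions of $r$. Then $$[M^{p\lambda}:Y^{p\mu}]=[M^\lambda:Y^\mu].$$
   Context: $\mathcal{S}_r$ is the symmetric group on $r$ letters and all modules are (finite-dimensional, right) modules over the field $k$ of characteristic $p$. For a partition $\lambda$ of $r$, $M^\lambda$ is the Young permutation module: the permutation $k\mathcal{S}_r$-module with basis the set of all $\lambda$-tabloids, equivalently the permutation module on the cosets of the Young subgroup $\mathcal{S}_\lambda=\mathcal{S}_{\lambda_1}\times\mathcal{S}_{\lambda_2}\times\cdots$. The Specht module $S^\lambda$ is the submodule of $M^\lambda$ generated by a polytabloid. In any decomposition of $M^\lambda$ into indecomposable summands there is exactly one summand containing $S^\lambda$ as a submodule; it is well defined up to isomorphism and is called the Young module $Y^\lambda$. Every indecomposable direct summand of $M^\lambda$ is isomorphic to some $Y^\mu$ with $\mu$ a partition of $r$, and $Y^\lambda\cong Y^\mu$ only if $\lambda=\mu$. The $p$-Kostka number $[M^\lambda:Y^\mu]$ is the multiplicity of $Y^\mu$ as a summand in a decomposition of $M^\lambda$ into indecomposable direct summands. For a positive integer $a$, $a\lambda$ is the partition of $ar$ obtained by multiplying every part of $\lambda$ by $a$. *)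

(* Defs.v *)
From HB Require Import structures.
From mathcomp Require Import all_boot all_order all_algebra all_fingroup.
From mathcomp Require Import mxrepresentation.
From mathcomp Require Import boolp.

Set Implicit Arguments.
Unset Strict Implicit.
Unset Printing Implicit Defensive.

Import GroupScope GRing.Theory.
Local Open Scope ring_scope.

Definition is_intpart (r : nat) (la : seq nat) : bool :=
  [&& sorted geq la, 0%N \notin la & sumn la == r].

Definition scale_part (a : nat) (la : seq nat) : seq nat :=
  [seq (a * l)%N | l <- la].

(* The boxes of the Young diagram of la, |la| = r, are numbered 0, ..., r-1,
   row after row and from left to right in each row: box number b lies in row
   [reshape_index la b] and in column [reshape_offset la b], both counted from
   0. A la-tableau is then a permutation t : 'S_r, the letter t b being written
   in box b. In MathComp (s * t) x = t (s x), so that g : 'S_r acts on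
   tableaux, on the right, by t |-> t * g (replace each letter x by g x), while
   s * t is obtained from t by permuting the boxes. *)

Definition young_subgroup (r : nat) (la : seq nat) : {set 'S_r} :=
  [set s : 'S_r | [forall b, reshape_index la (s b) == reshape_index la b]].

(* The tabloid of t is its row-equivalence class, which is the right coset of t
   modulo the Young subgroup. *)
Definition tabloid (r : nat) (la : seq nat) (t : 'S_r) : {set 'S_r} :=
  young_subgroup r la :* t.

Definition tabloids (r : nat) (la : seq nat) : {set {set 'S_r}} :=
  rcosets (young_subgroup r la) [set: 'S_r].

Definition column_stabilizer (r : nat) (la : seq nat) (t : 'S_r) : {set 'S_r} :=
  [set s : 'S_r | [forall x : 'I_r,
    reshape_offset la (t^-1%g (s x)) == reshape_offset la (t^-1%g x)]].

Section YoungPermutationModule.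

Variables (k : fieldType) (r : nat) (la : seq nat).

Definition young_perm_mx (g : 'S_r) : 'M[k]_#|tabloids r la| :=
  \matrix_(i, j) (enum_val j == enum_val i :* g)%:R.

Lemma young_perm_mx_repr : mx_repr [set: 'S_r] young_perm_mx.
Proof.
split=> [|g h _ _]; apply/matrixP=> i j; rewrite !mxE.
  by rewrite rcoset1 (inj_eq enum_val_inj) eq_sym.
have Tg : enum_val i :* g \in tabloids r la.
  have /rcosetsP[x _ ->] := enum_valP i.
  by rewrite -rcosetM; apply/rcosetsP; exists (x * g)%g; rewrite ?inE.
rewrite (bigD1 (enum_rank_in Tg (enum_val i :* g))) //= !mxE enum_rankK_in //.
rewrite eqxx mul1r -rcosetM big1 ?addr0 // => l neq_l; rewrite !mxE.
case: eqP => [eq_l|_]; last by rewrite mul0r.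
by case/eqP: neq_l; apply: enum_val_inj; rewrite enum_rankK_in.
Qed.

(* M^la: the right module with basis the la-tabloids; elements are row vectors
   and g acts by right multiplication by young_perm_mx g. *)
Definition young_perm_repr :
  mx_representation k [set: 'S_r] #|tabloids r la| :=
  MxRepresentation young_perm_mx_repr.

Definition tabloid_vec (t : 'S_r) : 'rV[k]_#|tabloids r la| :=
  \row_i (enum_val i == tabloid la t)%:R.

Definition polytabloid (t : 'S_r) : 'rV[k]_#|tabloids r la| :=
  \sum_(s in column_stabilizer la t)
     (-1) ^+ odd_perm s *: tabloid_vec (t * s)%g.

(* The submodule generated by polytabloid t does not depend on t, because
   polytabloid (t * g) is the image of polytabloid t under g. *)
Definition specht : 'M[k]_#|tabloids r la| :=
  cyclic_mx young_perm_repr (polytabloid 1%g).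

End YoungPermutationModule.

Definition mx_indecomposable (k : fieldType) (gT : finGroupType) (G : {group gT})
    (n : nat) (rG : mx_representation k G n) (U : 'M[k]_n) : Prop :=
  U != 0 /\
  forall V W : 'M[k]_n, mxmodule rG V -> mxmodule rG W ->
    (V + W :=: U)%MS -> mxdirect (V + W) -> V = 0 \/ W = 0.

Record indec_decomposition (k : fieldType) (gT : finGroupType) (G : {group gT})
    (n : nat) (rG : mx_representation k G n) := {
  dec_size : nat;
  dec_summand : 'I_dec_size -> 'M[k]_n;
  dec_mod : forall i, mxmodule rG (dec_summand i);
  dec_indec : forall i, mx_indecomposable rG (dec_summand i);
  dec_direct : mxdirect (\sum_i dec_summand i);
  dec_full : (\sum_i dec_summand i :=: 1%:M)%MS
}.

Arguments dec_summand {k gT G n rG} _ _.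
Arguments dec_mod {k gT G n rG} _ _.

Definition summand_repr (k : fieldType) (gT : finGroupType) (G : {group gT})
    (n : nat) (rG : mx_representation k G n)
    (D : indec_decomposition rG) (i : 'I_(dec_size D)) :=
  submod_repr (dec_mod D i).

Arguments summand_repr {k gT G n rG} _ _.

Definition multiplicity (k : fieldType) (gT : finGroupType) (G : {group gT})
    (n : nat) (rG : mx_representation k G n) (D : indec_decomposition rG)
    (m : nat) (rY : mx_representation k G m) : nat :=
  #|[set i | `[< mx_rsim (summand_repr D i) rY >]]|.

(* rY is a Young module Y^la: up to isomorphism, the summand containing S^la in
   a decomposition of M^la into indecomposables. *)
Definition is_young_module (k : fieldType) (r : nat) (la : seq nat) (m : nat)
    (rY : mx_representation k [set: 'S_r] m) : Prop :=
  exists (D : indec_decomposition (young_perm_repr k r la))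
         (i : 'I_(dec_size D)),
    (specht k r la <= dec_summand D i)%MS /\ mx_rsim (summand_repr D i) rY.

(* Main.v *)
From mathcomp Require Import all_boot all_order all_algebra all_fingroup.
From mathcomp Require Import mxrepresentation mxpoly cyclic.
From mathcomp Require Import boolp.
Require Import Defs.

(** Why the theorem holds. Write e for the standard polytabloid in M^mu. By
    James's lemma every endomorphism of M^mu multiplies e by a scalar
    (polytabloid_scalar), and Y^mu is the indecomposable summand of M^mu that
    contains e. For homomorphisms f : M^mu -> M^la and h : M^la -> M^mu, let
    b(f, h) be the scalar by which their composite acts on e. Decompose M^la
    into indecomposables and split b accordingly: by Fitting's lemma a summand
    contributes 0 unless it is isomorphic to Y^mu, and then it contributes a
    form of rank one. So [M^la : Y^mu] is the rank of b (leq_multiplicityP),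
    expressed below by the existence of families f_i and h_j with
    b(f_i, h_j) = delta_ij.

    The homomorphisms M^mu -> M^la have a basis indexed by the matrices of
    natural numbers with row sums mu and column sums la, and in this basis b is
    a signed count of pairs of a column permutation s of mu and a tabloid of
    shape la (polytabloid_form). Collecting these counts in a generating
    function in two matrices X and Y of indeterminates gives the product, over
    the columns of mu, of the leading principal minors of X Y^T whose sizes are
    the heights of the columns. Replacing mu by p mu raises this product to the
    p-th power, which in characteristic p amounts to raising the indeterminates
    to the p-th power. So the Gram matrix for (p mu, p la) is that for (mu, la),
    with the labels of the basis multiplied by p, bordered by zeros, and the two
    ranks agree. (The rank of b is the dimension of a weight space of the simple
    polynomial module L(mu), and this is Steinberg's isomorphism between L(p mu)
    and the Frobenius twist of L(mu).)

    The Frobenius step is proved without polynomials (polytabloid_form_scale):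
    the boxes of p mu come in blocks of p consecutive boxes, one block for each
    box of mu; the simultaneous cyclic shift of all blocks acts on the pairs that
    are counted for p mu, only its fixed points matter modulo p, and these are
    the pairs for mu, inflated. *)

Set Implicit Arguments.
Unset Strict Implicit.
Unset Printing Implicit Defensive.

Import GRing.Theory.
Local Open Scope ring_scope.

(** * Multiplicities and eigenvalues on a vector *)

Section Intertwiners.

Variables (k : fieldType) (gT : finGroupType) (G : {group gT}).

Definition intertwines (m n : nat) (rM : mx_representation k G m)
    (rN : mx_representation k G n) (f : 'M[k]_(m, n)) : Prop :=
  forall g, g \in G -> rM g *m f = f *m rN g.

Lemma intertwinesM m n l (rM : mx_representation k G m)
    (rN : mx_representation k G n) (rL : mx_representation k G l) f h :
  intertwines rM rN f -> intertwines rN rL h -> intertwines rM rL (f *m h).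
Proof. by move=> Hf Hh g Gg; rewrite mulmxA Hf // -!mulmxA Hh. Qed.

Lemma submod_indecomposable n (rM : mx_representation k G n) (U : 'M_n)
    (modU : mxmodule rM U) :
  mx_indecomposable rM U -> mx_indecomposable (submod_repr modU) 1%:M.
Proof.
case=> nzU indU; split=> [|V W modV modW defVW dxVW].
  by rewrite -mxrank_eq0 mxrank1 mxrank_eq0.
have inj m (A : 'M_(m, \rank U)) : val_submod A = 0 -> A = 0.
  by move/(congr1 (in_submod U)); rewrite val_submodK linear0.
pose V' := <<val_submod V>>%MS; pose W' := <<val_submod W>>%MS.
have [||||/eqP|/eqP] := indU V' W'.
- by rewrite (eqmx_module _ (genmxE _)) val_submod_module.
- by rewrite (eqmx_module _ (genmxE _)) val_submod_module.
- apply/eqmxP; rewrite addsmx_sub !genmxE !val_submodP /=.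
  rewrite -val_submod1.
  rewrite (submx_trans (_ : _ <= val_submod (V + W)%MS)%MS) //.
    by rewrite val_submodS defVW.
  have /sub_addsmxP[u ->] : (V + W <= V + W)%MS by [].
  rewrite linearD /= addmx_sub_adds //.
    by rewrite genmxE val_submodS submxMl.
  by rewrite genmxE val_submodS submxMl.
- apply/mxdirect_addsP/eqP; rewrite -submx0; apply/rV_subP=> v.
  rewrite sub_capmx !genmxE => /andP[vV vW].
  have vU : (v <= U)%MS by apply: submx_trans vV (val_submodP _).
  rewrite -(in_submodK vU) !val_submodS in vV vW.
  have : (in_submod U v <= V :&: W)%MS by rewrite sub_capmx vV.
  move/mxdirect_addsP: dxVW => ->; rewrite submx0 => /eqP v0.
  by rewrite -(in_submodK vU) v0 linear0 sub0mx.
- by rewrite -mxrank_eq0 genmxE mxrank_eq0 => /eqP/inj; left.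
- by rewrite -mxrank_eq0 genmxE mxrank_eq0 => /eqP/inj; right.
Qed.

Lemma horner_mx_eigenvector n (f : 'M[k]_n.+1) (v : 'rV_n.+1) c p :
  v *m f = c *: v -> v *m horner_mx f p = p.[c] *: v.
Proof.
move=> vf; elim/poly_ind: p => [|p a IH].
  by rewrite rmorph0 mulmx0 horner0 scale0r.
rewrite !hornerE rmorphD rmorphM /= horner_mx_X horner_mx_C scalerDl.
rewrite -scalerA mulmxDr mul_mx_scalar mulmxA IH -scalemxAl vf.
by rewrite !scalerA mulrC.
Qed.

(** A form of Fitting's lemma. Splitting off the power of 'X in the
    characteristic polynomial decomposes the module into the part where f is
    nilpotent and the part where it is invertible; one of them vanishes, and a
    nonzero eigenvalue rules out that it is the second. *)
Lemma indecomposable_eigenvalue_unit n (rM : mx_representation k G n)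
    (f : 'M_n) (v : 'rV_n) c :
  mx_indecomposable rM 1%:M -> intertwines rM rM f ->
  v != 0 -> c != 0 -> v *m f = c *: v -> f \in unitmx.
Proof.
case: n => [|n] in rM f v *; first by rewrite [v]thinmx0 eqxx.
case=> _ indM Hf nzv nzc vf.
have [m [q nq0 Dq]] := multiplicity_XsubC (char_poly f) 0.
rewrite monic_neq0 ?char_poly_monic //= in nq0; rewrite subr0 in Dq.
pose P : {poly k} := 'X^(m.+1).
have copr : coprimep P q.
  apply: coprimep_expl.
  by rewrite coprimep_sym -['X]subr0 -polyC0 coprimep_XsubC.
have PQ0 : horner_mx f (P * q) = 0.
  rewrite /P exprS -mulrA -[X in _ * X]mulrC -Dq rmorphM /=.
  by rewrite Cayley_Hamilton mulr0.
have modK p : mxmodule rM (kermxpoly f p).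
  apply/mxmoduleP => g Gg; apply: comm_mx_stable_kermxpoly.
  by rewrite /comm_mx Hf.
have vP p : v *m horner_mx f p = 0 -> p.[c] = 0.
  rewrite (horner_mx_eigenvector _ vf) => /eqP.
  by rewrite scaler_eq0 (negPf nzv) orbF => /eqP.
have [||||K0|K0] := indM (kermxpoly f P) (kermxpoly f q) => //.
- apply: eqmx_trans (eqmx_sym (kermxpolyM _ copr)) _.
  by rewrite /kermxpoly PQ0; apply: kermx0.
- by apply/mxdirect_addsP; rewrite mxdirect_kermxpoly.
- rewrite -row_free_unit -kermx_eq0; apply/eqP/row_matrixP => i; rewrite row0.
  apply/eqP; rewrite -submx0 -K0; apply/sub_kermxP.
  rewrite -row_mul rmorphXn /= horner_mx_X exprS mulmxA.
  by rewrite mulmx_ker mul0mx row0.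
- have qc : q.[c] != 0.
    apply: contra_neq nzv => qc; apply/eqP; rewrite -submx0 -K0.
    by apply/sub_kermxP; rewrite (horner_mx_eigenvector _ vf) qc scale0r.
  have /eqP : (P * q).[c] = 0 by rewrite vP // PQ0 mulmx0.
  by rewrite hornerM hornerXn mulf_eq0 (negPf qc) orbF expf_eq0 /= (negPf nzc).
Qed.

(** The inclusions and projections of a decomposition turn statements on
    submodules into matrix identities between representations. They are locked
    because both unfold to products, which rewriting with associativity would
    otherwise take apart. *)
Section Summands.

Variables (n : nat) (rM : mx_representation k G n) (D : indec_decomposition rM).

Let compl (i : 'I_(dec_size D)) := (\sum_(j | j != i) dec_summand D j)%MS.

Definition summand_inj i : 'M_(\rank (dec_summand D i), n) :=
  locked (val_submod 1%:M).
Definition summand_proj i : 'M_(n, \rank (dec_summand D i)) :=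
  locked (in_submod (dec_summand D i) (proj_mx (dec_summand D i) (compl i))).

Let compl_direct i : (dec_summand D i :&: compl i = 0)%MS.
Proof. by have /mxdirect_sumsP/(_ i isT) := dec_direct D. Qed.

Let compl_full i : (dec_summand D i + compl i :=: 1%:M)%MS.
Proof. by apply: eqmx_trans (dec_full D); rewrite (bigD1 i). Qed.

Lemma summand_proj_inj i :
  summand_proj i *m summand_inj i = proj_mx (dec_summand D i) (compl i).
Proof.
rewrite /summand_proj /summand_inj -!lock.
rewrite -[RHS](@in_submodK _ _ (dec_summand D i)) ?[RHS]val_submodE //.
by rewrite -[X in (X <= _)%MS]mul1mx proj_mx_sub.
Qed.

Lemma summand_projE i m (A : 'M_(m, n)) :
  A *m summand_proj i = in_submod _ (A *m proj_mx (dec_summand D i) (compl i)).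
Proof. by rewrite /summand_proj -lock [LHS]mulmxA. Qed.

Lemma summand_injK i : summand_inj i *m summand_proj i = 1%:M.
Proof.
rewrite summand_projE /summand_inj -lock proj_mx_id //; last exact: val_submodP.
by rewrite val_submodK.
Qed.

Lemma summand_inj_proj0 i j : i != j -> summand_inj i *m summand_proj j = 0.
Proof.
move=> neq_ij; rewrite summand_projE /summand_inj -lock proj_mx_0 ?linear0 //.
by apply: submx_trans (val_submodP _) _; rewrite (sumsmx_sup i).
Qed.

Lemma sum_summand_proj : \sum_i summand_proj i *m summand_inj i = 1%:M.
Proof.
have /sub_sumsmxP[u D1] : (1%:M <= \sum_i dec_summand D i)%MS.
  by rewrite dec_full.
rewrite [RHS]D1; apply: eq_bigr => i _; rewrite summand_proj_inj.
rewrite -[LHS]mul1mx D1 mulmx_suml (bigD1 i) //=.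
rewrite [u i *m _ *m _]proj_mx_id ?submxMl //.
rewrite big1 ?addr0 // => j neq_ji.
by rewrite proj_mx_0 // (sumsmx_sup j) // submxMl.
Qed.

Lemma summand_inj_hom i : intertwines (summand_repr D i) rM (summand_inj i).
Proof.
move=> g Gg; rewrite /summand_inj -lock.
rewrite -(val_submodJ (dec_mod D i) _ Gg) mul1mx.
by rewrite [RHS]val_submodE.
Qed.

Lemma summand_proj_hom i : intertwines rM (summand_repr D i) (summand_proj i).
Proof.
move=> g Gg; rewrite summand_projE /summand_proj -lock /summand_repr.
rewrite -in_submodJ; last first.
  by rewrite -[X in (X <= _)%MS]mul1mx proj_mx_sub.
congr (in_submod _ _).
have modC : mxmodule rM (compl i) by apply: sumsmx_module => j _; apply: dec_mod.
have := proj_mx_hom (compl_direct i) (dec_mod D i) modC.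
rewrite compl_full => /hom_mxP/(_ g Gg).
by rewrite !mul1mx.
Qed.

Lemma summand_indecomposable i : mx_indecomposable (summand_repr D i) 1%:M.
Proof. exact/submod_indecomposable/dec_indec. Qed.

End Summands.

Lemma mx_rsim_intertwines m n (rM : mx_representation k G m)
    (rN : mx_representation k G n) :
  mx_rsim rM rN -> exists f h,
    [/\ intertwines rM rN f, intertwines rN rM h & f *m h = 1%:M].
Proof.
case=> f eq_mn freef homf; case: n / eq_mn in rN f freef homf *.
exists f, (invmx f); rewrite row_free_unit in freef; split=> //.
  move=> g Gg; rewrite -[LHS](mulKmx freef) (mulmxA f) -homf //.
  by rewrite mulmxK.
exact: mulmxV.
Qed.

Lemma units_mx_rsim m n (rM : mx_representation k G m)
    (rN : mx_representation k G n) f h :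
  intertwines rM rN f -> f *m h \in unitmx -> h *m f \in unitmx ->
  mx_rsim rM rN.
Proof.
move=> homf ufh uhf.
have le_mn : (m <= n)%N.
  by rewrite -(mxrank_unit ufh) (leq_trans (mxrankM_maxl _ _)) ?rank_leq_col.
have le_nm : (n <= m)%N.
  by rewrite -(mxrank_unit uhf) (leq_trans (mxrankM_maxl _ _)) ?rank_leq_col.
exists f => //; first by apply/eqP; rewrite eqn_leq le_mn.
by rewrite -row_leq_rank -{1}(mxrank_unit ufh) mxrankM_maxl.
Qed.

(** The vector e plays the role of a highest weight vector: every endomorphism
    of M scales it. It lies in the summand D0 i0, which is thereby the one that
    the eigenvalues on e detect. *)
Section MultiplicityAsRank.

Variables (m n : nat).
Variables (rM : mx_representation k G m) (rN : mx_representation k G n).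
Variables (e : 'rV[k]_m) (D0 : indec_decomposition rM) (i0 : 'I_(dec_size D0)).
Variables (D : indec_decomposition rN) (l : nat) (rY : mx_representation k G l).

Hypothesis nz_e : e != 0.
Hypothesis scal_e : forall f, intertwines rM rM f -> exists c, e *m f = c *: e.
Hypothesis e_in : (e <= dec_summand D0 i0)%MS.
Hypothesis Y_sim : mx_rsim (summand_repr D0 i0) rY.

(** Such families exist for a given d exactly when the bilinear form that sends
    (f, h) to the eigenvalue of f *m h on e has rank at least d; the two lemmas
    below identify the largest possible d with a multiplicity. *)
Definition dual_families (d : nat) (f : 'I_d -> 'M[k]_(m, n))
    (h : 'I_d -> 'M[k]_(n, m)) : Prop :=
  [/\ forall i, intertwines rM rN (f i), forall j, intertwines rN rM (h j)
    & forall i j, e *m f i *m h j = (i == j)%:R *: e].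

Let e0 : 'rV_(\rank (dec_summand D0 i0)) := e *m summand_proj i0.

Let e0K : e0 *m summand_inj i0 = e.
Proof.
rewrite -mulmxA summand_proj_inj proj_mx_id //.
by have /mxdirect_sumsP/(_ i0 isT) := dec_direct D0.
Qed.

Let nz_e0 : e0 != 0.
Proof. by apply: contra_neq nz_e => e00; rewrite -e0K e00 mul0mx. Qed.

Let scal_e0 f : intertwines (summand_repr D0 i0) (summand_repr D0 i0) f ->
  exists c, e0 *m f = c *: e0.
Proof.
move=> homf; have [|c ec] := scal_e (f := summand_proj i0 *m f *m summand_inj i0).
  apply: intertwinesM (@summand_inj_hom _ _ _ _).
  by apply: intertwinesM homf; apply: summand_proj_hom.
exists c; rewrite [RHS]scalemxAl -ec !mulmxA -[RHS]mulmxA summand_injK.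
by rewrite mulmx1.
Qed.

Let copies := [set i | `[< mx_rsim (summand_repr D i) rY >]].

(** Go from M onto the summand that contains e, then by an isomorphism into one
    of the copies of it in N, and back: distinct copies are orthogonal. *)
Lemma dual_families_of_multiplicity :
  exists f h, @dual_families (multiplicity D rY) f h.
Proof.
have iso (j : 'I_(multiplicity D rY)) : exists fh : 'M[k]_(m, n) * 'M[k]_(n, m),
    [/\ intertwines rM rN fh.1, intertwines rN rM fh.2
      & exists x y, [/\ fh.1 = summand_proj i0 *m x *m summand_inj (enum_val j),
          fh.2 = summand_proj (enum_val j) *m y *m summand_inj i0
        & x *m y = 1%:M]].
  have := enum_valP j; rewrite inE => /asboolP Yj.
  have [x [y [homx homy xy]]] :=
    mx_rsim_intertwines (mx_rsim_trans Y_sim (mx_rsim_sym Yj)).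
  exists (summand_proj i0 *m x *m summand_inj (enum_val j),
          summand_proj (enum_val j) *m y *m summand_inj i0).
  split; last by exists x, y.
    by do !apply: intertwinesM;
      [apply: summand_proj_hom | apply: homx | apply: summand_inj_hom].
  by do !apply: intertwinesM;
    [apply: summand_proj_hom | apply: homy | apply: summand_inj_hom].
have [fh fhP] := choice iso.
exists (fun j => (fh j).1), (fun j => (fh j).2).
split=> [i|j|i j]; [by have [] := fhP i | by have [] := fhP j | ].
have [<-|neq_ij] := eqVneq i j; last first.
  have [_ _ [x [_ [-> _ _]]]] := fhP i; have [_ _ [_ [y [_ -> _]]]] := fhP j.
  rewrite !mulmxA -[_ *m summand_inj _ *m summand_proj _]mulmxA.
  rewrite summand_inj_proj0 ?mulmx0 ?mul0mx ?scale0r //.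
  by rewrite (inj_eq enum_val_inj).
have [_ _ [x [y [-> -> xy]]]] := fhP i.
rewrite !mulmxA -[_ *m summand_inj _ *m summand_proj _]mulmxA.
by rewrite summand_injK mulmx1 -[_ *m x *m y]mulmxA xy mulmx1 scale1r e0K.
Qed.

(** Insert the decomposition of the identity of N between f i and h j. The
    endomorphism of the summand of M that factors through a summand of N not
    isomorphic to it cannot have a nonzero eigenvalue on e, since it would then
    be invertible; a summand that is a copy contributes a matrix of rank one,
    because eigenvalues on e multiply. So the identity matrix of size d factors
    through a space whose dimension is the number of copies. *)
Lemma multiplicity_of_dual_families d f h :
  @dual_families d f h -> (d <= multiplicity D rY)%N.
Proof.
case=> homf homh fh.
(* u and w are the components of f and h at the summand t of N *)
have rank1 (t : 'I_(dec_size D)) u w :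
    (forall i, intertwines (summand_repr D0 i0) (summand_repr D t) (u i)) ->
    (forall j, intertwines (summand_repr D t) (summand_repr D0 i0) (w j)) ->
  exists ab : ('I_d -> k) * ('I_d -> k), forall i j,
    e0 *m u i *m w j = ((t \in copies)%:R * (ab.1 i * ab.2 j)) *: e0.
  move=> homu homw; rewrite inE; case: asboolP => [Yt|nYt]; last first.
    exists (fun=> 0, fun=> 0) => i j; rewrite mul0r scale0r.
    have [c ec] := scal_e0 (intertwinesM (homu i) (homw j)).
    have [c0|nzc] := eqVneq c 0; first by rewrite -mulmxA ec c0 scale0r.
    case: nYt; apply: mx_rsim_trans Y_sim; apply: mx_rsim_sym.
    apply: (units_mx_rsim (h := w j) (homu i)).
      apply: indecomposable_eigenvalue_unit nz_e0 nzc ec.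
        exact: summand_indecomposable.
      exact: intertwinesM (homu i) (homw j).
    apply: (indecomposable_eigenvalue_unit (v := e0 *m u i) _ _ _ nzc).
    - exact: summand_indecomposable.
    - exact: intertwinesM (homw j) (homu i).
    - apply: contra_neq nz_e0 => eu0; move/eqP: ec.
      by rewrite mulmxA eu0 mul0mx eq_sym scaler_eq0 (negPf nzc) => /eqP.
    - by rewrite mulmxA -[_ *m w j]mulmxA ec scalemxAl.
  have [x [y [homx homy xy]]] :=
    mx_rsim_intertwines (mx_rsim_trans Yt (mx_rsim_sym Y_sim)).
  have [a aP] := choice (fun i => scal_e0 (intertwinesM (homu i) homx)).
  have [b bP] := choice (fun j => scal_e0 (intertwinesM homy (homw j))).
  exists (a, b) => i j /=; rewrite mul1r.
  rewrite -[u i]mulmx1 -xy !mulmxA -(mulmxA e0) aP -(mulmxA _ y) -scalemxAl bP.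
  by rewrite scalerA.
have step (t : 'I_(dec_size D)) : exists ab : ('I_d -> k) * ('I_d -> k),
    forall i j, e0 *m (summand_inj i0 *m f i *m summand_proj t)
      *m (summand_inj t *m h j *m summand_proj i0)
      = ((t \in copies)%:R * (ab.1 i * ab.2 j)) *: e0.
  apply: (rank1 t (fun i => _) (fun j => _)) => i.
    by do !apply: intertwinesM;
      [apply: summand_inj_hom | apply: homf | apply: summand_proj_hom].
  by do !apply: intertwinesM;
    [apply: summand_inj_hom | apply: homh | apply: summand_proj_hom].
have [ab abP] := choice step.
pose A : 'M[k]_(d, #|copies|) := \matrix_(i, t) (ab (enum_val t)).1 i.
pose B : 'M[k]_(#|copies|, d) := \matrix_(t, j) (ab (enum_val t)).2 j.
have AB1 : A *m B = 1%:M.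
  apply/matrixP => i j; rewrite !mxE; under eq_bigr do rewrite !mxE.
  apply/eqP; rewrite -subr_eq0; have /eqP := nz_e0; move/eqP.
  set z := _ - _ => nz0; suff: z *: e0 == 0.
    by rewrite scaler_eq0 (negPf nz0) orbF.
  rewrite scalerBl subr_eq0; apply/eqP.
  have -> : (i == j)%:R *: e0
      = e0 *m summand_inj i0 *m f i *m h j *m summand_proj i0.
    by rewrite e0K fh -scalemxAl.
  rewrite -[f i]mulmx1 -(sum_summand_proj D) mulmx_sumr mulmx_sumr !mulmx_suml.
  rewrite -(big_enum_val (fun t => (ab t).1 i * (ab t).2 j)) /=.
  rewrite scaler_suml big_mkcond /=.
  apply: eq_bigr => t _; move: (abP t i j); rewrite !mulmxA => ->.
  by case: (t \in copies); rewrite ?mul1r // mul0r scale0r.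
rewrite -[d](mxrank1 k) -AB1 (leq_trans (mxrankM_maxl _ _)) ?rank_leq_col //.
Qed.
End MultiplicityAsRank.
End Intertwiners.

(** * Tabloids as words *)

Lemma eq_fibers_perm (r : nat) (E : eqType) (f g : 'I_r -> E) :
    (forall c, #|[set x | f x == c]| = #|[set x | g x == c]|) ->
  exists t : 'S_r, forall x, g x = f (t x).
Proof.
have cnt h c : count_mem c [tuple h i | i < r] = #|[set x | h x == c]|.
  by rewrite /= count_map cardsE cardE size_filter enumT; apply: eq_count.
move=> fib; have : perm_eq [tuple g i | i < r] [tuple f i | i < r].
  by apply/allP => c _; apply/eqP; move: (fib c); rewrite -!cnt => ->.
case/tuple_permP => t eq_gt; exists t => x.
have := congr1 (fun s => tnth s x) (val_inj eq_gt : [tuple g i | i < r] = _).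
by rewrite !tnth_map !tnth_ord_tuple.
Qed.

(** A tabloid is encoded by the word that gives for each letter its row. The
    alphabet 'I_n.+1 only has to be large enough for all rows; since it does not
    depend on r, words of la and of p la use the same one. *)
Section Words.

Variables r n : nat.
Implicit Types (la mu : seq nat) (t s g : 'S_r) (w : {ffun 'I_r -> 'I_n.+1}).

Definition word la t : {ffun 'I_r -> 'I_n.+1} :=
  [ffun x => inord (reshape_index la (t^-1%g x))].

Definition words la : {set {ffun 'I_r -> 'I_n.+1}} :=
  [set word la t | t : 'S_r].

Definition word_act w g : {ffun 'I_r -> 'I_n.+1} := [ffun x => w (g^-1%g x)].

(** For the words of a mu-tabloid and of a la-tabloid, the matrix with row sums
    mu and column sums la that labels a double coset of two Young subgroups. *)
Definition joint w1 w2 : {ffun 'I_n.+1 * 'I_n.+1 -> nat} :=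
  [ffun ia => #|[set x | (w1 x, w2 x) == ia]|].

Lemma word_mul la t g : word la (t * g)%g = word_act (word la t) g.
Proof. by apply/ffunP => x; rewrite !ffunE invMg permM. Qed.

Lemma joint_act w1 w2 g : joint (word_act w1 g) (word_act w2 g) = joint w1 w2.
Proof.
apply/ffunP => ia; rewrite !ffunE -(card_preimset _ (@perm_inj _ g)).
by congr #|pred_of_set _|; apply/setP => x; rewrite !inE !ffunE permK.
Qed.

(** These matrices classify the orbits of the symmetric group on pairs of
    tabloids. *)
Lemma joint_eq w1 w2 w1' w2' : joint w1 w2 = joint w1' w2' ->
  exists g, w1' = word_act w1 g /\ w2' = word_act w2 g.
Proof.
move/ffunP => eqJ.
have [|t tP] :=
  @eq_fibers_perm r _ (fun x => (w1 x, w2 x)) (fun x => (w1' x, w2' x)).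
  by move=> ia; have := eqJ ia; rewrite !ffunE.
by exists t^-1%g; split; apply/ffunP => x; rewrite ffunE invgK; have [] := tP x.
Qed.

Section Shape.

Variable la : seq nat.
Hypotheses (sum_la : sumn la = r) (size_la : (size la <= n.+1)%N).

Lemma row_lt (x : 'I_r) : (reshape_index la x < n.+1)%N.
Proof. by apply: leq_trans size_la; rewrite reshape_indexP ?sum_la. Qed.

Lemma wordE t x : word la t x = reshape_index la (t^-1%g x) :> nat.
Proof. by rewrite ffunE inordK ?row_lt. Qed.

Lemma young_subgroup_group_set : group_set (young_subgroup r la).
Proof.
apply/group_setP; split=> [|s t].
  by rewrite inE; apply/forallP => x; rewrite perm1.
rewrite !inE => /forallP Ys /forallP Yt; apply/forallP => x.
by rewrite permM (eqP (Yt _)).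
Qed.

Let Y := Group young_subgroup_group_set.

Lemma mem_tabloid t u : (u \in tabloid la t) = (word la u == word la t).
Proof.
rewrite /tabloid mem_rcoset inE; apply/forallP/eqP => [Yut|eq_ut b].
  apply/ffunP => x; apply: val_inj; rewrite /= !wordE.
  by have := Yut (u^-1%g x); rewrite permM permKV => /eqP.
have /(congr1 (fun w => nat_of_ord (w (u b)))) := eq_ut.
by rewrite !wordE permK permM => ->.
Qed.

Lemma tabloid_eq t u : (tabloid la t == tabloid la u) = (word la t == word la u).
Proof.
by rewrite -mem_tabloid; apply: (sameP eqP); apply: (@rcoset_eqP _ Y).
Qed.

Definition tabloid_word (T : {set 'S_r}) := word la (repr T).

Lemma tabloid_wordE t : tabloid_word (tabloid la t) = word la t.
Proof. by apply/eqP; rewrite -mem_tabloid; apply: (mem_repr_rcoset Y). Qed.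

Lemma tabloidsP T : reflect (exists t, T = tabloid la t) (T \in tabloids r la).
Proof.
apply: (iffP rcosetsP) => [[t _ ->]|[t ->]]; first by exists t.
by exists t; rewrite ?inE.
Qed.

Lemma tabloid_word_act t g :
  tabloid_word (tabloid la t :* g)%g = word_act (tabloid_word (tabloid la t)) g.
Proof. by rewrite -rcosetM -/(tabloid _ _) !tabloid_wordE word_mul. Qed.

Definition index_word (i : 'I_#|tabloids r la|) := tabloid_word (enum_val i).

Lemma index_word_inj : injective index_word.
Proof.
move=> i j; rewrite /index_word.
have /tabloidsP[t Et] := enum_valP i; have /tabloidsP[u Eu] := enum_valP j.
rewrite Et Eu !tabloid_wordE => /eqP; rewrite -tabloid_eq => /eqP eqT.
by apply: enum_val_inj; rewrite Et Eu.
Qed.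

Lemma index_of_word t : exists i, index_word i = word la t.
Proof.
have Tt : tabloid la t \in tabloids r la by apply/tabloidsP; exists t.
exists (enum_rank_in Tt (tabloid la t)).
by rewrite /index_word enum_rankK_in // tabloid_wordE.
Qed.

Lemma index_word_in i : exists t, index_word i = word la t.
Proof.
have /tabloidsP[t Et] := enum_valP i.
by exists t; rewrite /index_word Et tabloid_wordE.
Qed.

Lemma enum_val_tabloid i t :
  (enum_val i == tabloid la t) = (index_word i == word la t).
Proof.
by rewrite /index_word; have /tabloidsP[u ->] := enum_valP i;
  rewrite tabloid_wordE tabloid_eq.
Qed.

Lemma enum_val_act i j g :
  (enum_val j == (enum_val i :* g)%g) = (index_word j == word_act (index_word i) g).
Proof.
rewrite /index_word; have /tabloidsP[u ->] := enum_valP i.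
have /tabloidsP[t ->] := enum_valP j.
by rewrite -tabloid_word_act -rcosetM -/(tabloid _ _) !tabloid_wordE tabloid_eq.
Qed.

Lemma index_act i g : exists j, index_word j = word_act (index_word i) g.
Proof.
by have [t ->] := index_word_in i; rewrite -word_mul; apply: index_of_word.
Qed.

Lemma big_index_word (V : nmodType) (F : {ffun 'I_r -> 'I_n.+1} -> V) :
  \sum_i F (index_word i) = \sum_(w in words la) F w.
Proof.
transitivity (\sum_(w in [set index_word i | i : 'I_#|tabloids r la|]) F w).
  by rewrite big_imset //= => i j _ _; apply: index_word_inj.
apply: eq_bigl => w; apply/imsetP/imsetP => [[i _ ->]|[t _ ->]].
  by have [t ->] := index_word_in i; exists t.
by have [i <-] := index_of_word t; exists i.
Qed.

End Shape.

End Words.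

(** * Homomorphisms between Young permutation modules *)

Section SchurAlgebra.

Variables (k : fieldType) (r n : nat) (mu la : seq nat).
Hypotheses (sum_mu : sumn mu = r) (size_mu : (size mu <= n.+1)%N).
Hypotheses (sum_la : sumn la = r) (size_la : (size la <= n.+1)%N).

Local Notation jtype := {ffun 'I_n.+1 * 'I_n.+1 -> nat}.
Local Notation mu_word := (@index_word r n mu).
Local Notation la_word := (@index_word r n la).

(** Here alpha is the family of coordinates in the usual basis of
    Hom(M^mu, M^la), indexed by the orbits on pairs of tabloids, that is, by
    joint matrices. *)
Definition schur_mx (alpha : jtype -> k) :
    'M[k]_(#|tabloids r mu|, #|tabloids r la|) :=
  \matrix_(i, j) alpha (joint (mu_word i) (la_word j)).

Lemma young_perm_mxM g m (f : 'M[k]_(_, m)) i i' j :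
  mu_word i' = word_act (mu_word i) g ->
  (young_perm_mx k mu g *m f) i j = f i' j.
Proof.
move=> Di'; rewrite mxE (bigD1 i') //= mxE (enum_val_act sum_mu size_mu).
rewrite Di' eqxx mul1r.
rewrite big1 ?addr0 // => l neq_l.
rewrite mxE (enum_val_act sum_mu size_mu) -Di'.
rewrite (inj_eq (index_word_inj sum_mu size_mu)).
by rewrite (negPf neq_l) mul0r.
Qed.

Lemma mul_young_perm_mx g m (f : 'M[k]_(m, _)) i j j' :
  la_word j' = word_act (la_word j) g ->
  (f *m young_perm_mx k la g) i j' = f i j.
Proof.
move=> Dj'; rewrite mxE (bigD1 j) //= mxE (enum_val_act sum_la size_la).
rewrite Dj' eqxx mulr1.
rewrite big1 ?addr0 // => l neq_l.
rewrite mxE (enum_val_act sum_la size_la) Dj'.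
case: eqP => [eq_a|]; last by rewrite mulr0.
case/eqP: neq_l; apply/(index_word_inj sum_la size_la)/ffunP => x.
by have /ffunP/(_ (g x)) := eq_a; rewrite !ffunE permK.
Qed.

Lemma schur_mx_intertwines alpha :
  intertwines (young_perm_repr k r mu) (young_perm_repr k r la) (schur_mx alpha).
Proof.
move=> g _; apply/matrixP => i j'.
have [i' Di'] := index_act sum_mu size_mu i g.
have [j Dj] := index_act sum_la size_la j' g^-1.
have Dj' : la_word j' = word_act (la_word j) g.
  by rewrite Dj; apply/ffunP => x; rewrite !ffunE invgK permKV.
rewrite (young_perm_mxM _ _ Di') (mul_young_perm_mx _ _ Dj') !mxE.
by rewrite Di' Dj' joint_act.
Qed.

(** An intertwining matrix is constant on the orbits of pairs of tabloids, hence
    a function of the joint matrix. *)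
Lemma intertwines_schur_mx f :
    intertwines (young_perm_repr k r mu) (young_perm_repr k r la) f ->
  exists alpha, f = schur_mx alpha.
Proof.
move=> homf.
exists (fun J =>
  if [pick ij | joint (mu_word ij.1) (la_word ij.2) == J] is Some ij
  then f ij.1 ij.2 else 0).
apply/matrixP => i j; rewrite mxE.
case: pickP => [[i' j'] /= /eqP eqJ|]; last first.
  by move/(_ (i, j)); rewrite eqxx.
have [g [Di Dj]] := joint_eq eqJ.
have /matrixP/(_ i' j) := homf g (in_setT _).
by rewrite (young_perm_mxM _ _ Di) (mul_young_perm_mx _ _ Dj).
Qed.

End SchurAlgebra.

(** * Endomorphisms scale the polytabloid *)

Lemma sum_card_fibers (T I : finType) (g : T -> I) (P : pred T) :
  (\sum_a #|[set y | (g y == a) && P y]| = #|[set y | P y]|)%N.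
Proof.
rewrite -[RHS]sum1_card (partition_big g predT) //=; apply: eq_bigr => a _.
by rewrite -sum1_card; apply: eq_bigl => y; rewrite !inE andbC.
Qed.

Section Polytabloid.

Variables (k : fieldType) (r n : nat) (mu : seq nat).
Hypotheses (sum_mu : sumn mu = r) (size_mu : (size mu <= n.+1)%N).
Local Notation W := (@index_word r n mu).
Local Notation C := (column_stabilizer mu (1%g : 'S_r)).
Local Notation tv := (@tabloid_vec k r mu).
Local Notation e := (@polytabloid k r mu 1%g).
Local Notation row x := (reshape_index mu x).
Local Notation col x := (reshape_offset mu x).

Lemma column_stabilizerP (s : 'S_r) :
  reflect (forall x : 'I_r, col (s x) = col x) (s \in C).
Proof.
rewrite inE; apply: (iffP forallP) => Cs x.
  by have := eqP (Cs x); rewrite invg1 !perm1.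
by rewrite invg1 !perm1 Cs.
Qed.

Lemma box_eq (x y : 'I_r) : row x = row y -> col x = col y -> x = y.
Proof.
move=> eqr eqc; apply: val_inj.
by rewrite /= -(reshape_indexK mu x) eqr eqc reshape_indexK.
Qed.

Lemma tabloid_vecE t i : tv t 0 i = (W i == word n mu t)%:R.
Proof. by rewrite mxE (enum_val_tabloid sum_mu size_mu). Qed.

Lemma eq_tabloid_vec t u : word n mu t = word n mu u -> tv t = tv u.
Proof. by move=> eq_tu; apply/rowP => i; rewrite !tabloid_vecE eq_tu. Qed.

Lemma tabloid_vec_delta t i : W i = word n mu t -> tv t = delta_mx 0 i.
Proof.
move=> Di; apply/rowP => j; rewrite tabloid_vecE mxE eqxx -Di.
by rewrite (inj_eq (index_word_inj sum_mu size_mu)).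
Qed.

Lemma tabloid_vec_act t g : tv t *m young_perm_mx k mu g = tv (t * g)%g.
Proof.
have [i Di] := index_of_word sum_mu size_mu t.
have [j Dj] := index_act sum_mu size_mu i g.
rewrite (tabloid_vec_delta Di).
rewrite (@tabloid_vec_delta (t * g)%g j) ?Dj ?Di ?word_mul //.
apply/rowP => l; rewrite -rowE !mxE (enum_val_act sum_mu size_mu) -Dj.
by rewrite (inj_eq (index_word_inj sum_mu size_mu)) eqxx.
Qed.

Lemma polytabloid1E : e = \sum_(s in C) (-1) ^+ odd_perm s *: tv s.
Proof. by apply: eq_bigr => s _; rewrite mul1g. Qed.

(** A permutation that preserves both rows and columns fixes every box, so only
    the identity contributes. *)
Lemma polytabloid_coef1 i : W i = word n mu 1 -> e 0 i = 1.
Proof.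
move=> Di; rewrite polytabloid1E summxE (bigD1 1%g) /=; last first.
  by apply/column_stabilizerP => x; rewrite perm1.
rewrite mxE tabloid_vecE Di eqxx odd_perm1 expr0 mulr1 big1 ?addr0 // => s.
case/andP=> /column_stabilizerP Cs nts; rewrite mxE tabloid_vecE Di.
case: eqP => [eqw|]; last by rewrite mulr0.
case/eqP: nts; apply/permP => x; rewrite perm1; apply: box_eq => //.
have /ffunP/(_ (s x))/(congr1 val) /= := eqw.
by rewrite !(wordE sum_mu size_mu) permK invg1 perm1.
Qed.

Lemma polytabloid_neq0 : e != 0.
Proof.
have [i Di] := index_of_word sum_mu size_mu 1.
apply/eqP => /rowP/(_ i); rewrite (polytabloid_coef1 Di) mxE => /eqP.
by rewrite oner_eq0.
Qed.

(** In the filling that writes row (t x) in box x, the entry a occurs as often as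
    there are boxes in row a, but at most once in each column. Hence among the
    first c columns it occurs at most min(c, mu_a) times, that is, at most as
    often as row a meets these columns. Summed over a, both counts give the
    number of boxes in the first c columns, so equality holds for each a; for
    c = mu_a this says that a occurs in the first mu_a columns only. *)
Lemma column_injective_filling (t : 'S_r) :
    (forall x y : 'I_r, col x = col y -> row (t x) = row (t y) -> x = y) ->
  forall x : 'I_r, (col x < nth 0 mu (row (t x)))%N.
Proof.
move=> inj_t x; rewrite ltnNge; apply/negP => ge_col.
pose ro (y : 'I_r) : 'I_n.+1 := Ordinal (row_lt sum_mu size_mu y).
(* N counts the entries a of the filling, and R the boxes of row a, that lie
   in the first c columns *)
pose N c (a : 'I_n.+1) := #|[set y : 'I_r | (ro (t y) == a) && (col y < c)%N]|.
pose R c (a : 'I_n.+1) := #|[set y : 'I_r | (ro y == a) && (col y < c)%N]|.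
have card_row (a : 'I_n.+1) :
    #|[set y : 'I_r | ro (t y) == a]| = #|[set y : 'I_r | ro y == a]|.
  rewrite -[RHS](card_preimset _ (@perm_inj _ t)).
  by congr #|pred_of_set _|; apply/setP => y; rewrite !inE.
have full_row c (a : 'I_n.+1) :
    (nth 0 mu a <= c)%N -> R c a = #|[set y : 'I_r | ro y == a]|.
  move=> le_c; congr #|pred_of_set _|; apply/setP => y.
  rewrite !inE andb_idr //.
  move=> /eqP Da; apply: leq_trans le_c.
  by rewrite -Da /= reshape_offsetP ?sum_mu.
have le_NR c (a : 'I_n.+1) : (N c a <= R c a)%N.
  have [le_c|gt_c] := leqP (nth 0 mu a) c.
    rewrite full_row // -card_row subset_leq_card //.
    by apply/subsetP => y; rewrite !inE => /andP[].
  apply: (@leq_trans c).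
    rewrite /N cardE -(size_map (fun y : 'I_r => col y)) -[leqRHS](size_iota 0).
    apply: uniq_leq_size => [|_ /mapP[y y_in ->]]; last first.
      by move: y_in; rewrite mem_enum mem_iota inE => /andP[].
    rewrite map_inj_in_uniq ?enum_uniq // => y z.
    rewrite !mem_enum !inE => /andP[/eqP ty _] /andP[/eqP tz _] eqc.
    by apply: inj_t => //; rewrite -tz in ty; apply: (congr1 val ty).
  have lt_box (j : 'I_c) : (flatten_index mu a j < r)%N.
    by rewrite -sum_mu flatten_indexP // (ltn_trans (ltn_ord j)).
  have boxK (j : 'I_c) :
      col (flatten_index mu a j) = j /\ row (flatten_index mu a j) = a.
    by rewrite flatten_indexKr ?flatten_indexKl // (ltn_trans (ltn_ord j)).
  rewrite -[leqLHS](card_ord c) -cardsT.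
  rewrite -(card_imset _ (_ : injective (fun j : 'I_c => Ordinal (lt_box j)))).
    apply/subset_leq_card/subsetP => _ /imsetP[j _ ->]; rewrite inE.
    by have [cj rj] := boxK j; rewrite -val_eqE /= cj rj eqxx /=.
  move=> i j [/(congr1 (fun b => col b))]; have [-> _] := boxK i.
  by have [-> _] := boxK j => /val_inj.
pose a := ro (t x); pose c := nth 0 mu a.
have : (\sum_a N c a == \sum_a R c a)%N by rewrite !sum_card_fibers.
have [_ ->] := leqif_sum (fun a (_ : xpredT a) => leqif_eq (le_NR c a)).
move/forallP/(_ a)/eqP; apply/eqP.
rewrite full_row // -card_row neq_ltn proper_card //.
apply/properP; split; first by apply/subsetP => y; rewrite !inE => /andP[].
by exists x; rewrite inE eqxx // ltnNge ge_col.
Qed.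

(** The permutation s moves x inside its column to the row prescribed by t, where
    a box exists by the preceding lemma. *)
Lemma column_injective_tabloid (t : 'S_r) :
    (forall x y : 'I_r,
       col x = col y -> row (t^-1%g x) = row (t^-1%g y) -> x = y) ->
  exists2 s, s \in C & word n mu t = word n mu s.
Proof.
move=> inj_t; have box_ok := column_injective_filling inj_t.
have lt_box (x : 'I_r) : (flatten_index mu (row (t^-1%g x)) (col x) < r)%N.
  by rewrite -[X in (_ < X)%N]sum_mu flatten_indexP.
pose h x := Ordinal (lt_box x).
have hc x : col (h x) = col x by rewrite /= flatten_indexKr.
have hr x : row (h x) = row (t^-1%g x) by rewrite /= flatten_indexKl.
have inj_h : injective h.
  move=> x y eq_h; apply: inj_t; first by rewrite -[LHS]hc eq_h hc.
  by rewrite -[LHS]hr eq_h hr.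
exists (perm inj_h)^-1%g.
  apply/column_stabilizerP => x.
  by rewrite -[in RHS](permKV (perm inj_h) x) permE hc.
apply/ffunP => x; apply: val_inj; rewrite [LHS](wordE sum_mu size_mu).
by rewrite [RHS](wordE sum_mu size_mu) invgK (permE inj_h) hr.
Qed.

(** If two letters share a column of the standard tableau and a row of t, their
    transposition pairs off the terms of the sum with opposite signs (a
    cancellation that also works in characteristic 2); otherwise the tabloid of
    t is the image of the standard one under the column stabilizer. *)
Lemma column_antisymmetrizer t :
  exists c, \sum_(s in C) (-1) ^+ odd_perm s *: tv (t * s)%g = c *: e.
Proof.
have [inj_t|] := pselect (forall x y : 'I_r,
    col x = col y -> row (t^-1%g x) = row (t^-1%g y) -> x = y).
  have [s0 /column_stabilizerP Cs0 eqw] := column_injective_tabloid inj_t.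
  exists ((-1) ^+ odd_perm s0); rewrite polytabloid1E scaler_sumr.
  rewrite [RHS](reindex_inj (mulgI s0)) /=; apply: eq_big => [s|s _].
    apply/column_stabilizerP/column_stabilizerP => Cs x.
      by rewrite permM Cs Cs0.
    by rewrite -[in LHS](permKV s0 x) -permM Cs -Cs0 permKV.
  rewrite scalerA odd_permM signr_addb mulrA -expr2 sqrr_sign mul1r.
  by congr (_ *: _); apply: eq_tabloid_vec; rewrite !word_mul eqw.
move=> ninj; exists 0; rewrite scale0r.
have [x [y [eqc eqr /eqP neq_xy]]] : exists x y : 'I_r,
    [/\ col x = col y, row (t^-1%g x) = row (t^-1%g y) & x <> y].
  apply: contra_notP ninj => nex x y eqc eqr.
  by apply: contra_notP nex => neq; exists x, y.
pose tau := tperm x y.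
have Ctau : forall z : 'I_r, col (tau z) = col z.
  by move=> z; rewrite /tau; case: tpermP => [->|->|].
have eqw : word n mu (t * tau)%g = word n mu t.
  apply/ffunP => z; apply: val_inj; rewrite /= !(wordE sum_mu size_mu).
  by rewrite invMg permM tpermV; case: tpermP => [->|->|].
rewrite (bigID (@odd_perm _)) /=; apply/eqP; rewrite addr_eq0 -sumrN; apply/eqP.
rewrite (reindex_inj (mulgI tau)) /=; apply: eq_big => [s|s _]; last first.
  rewrite odd_permM odd_tperm neq_xy signr_addb -scaleNr; congr (_ *: _).
    by rewrite mulN1r.
  by apply: eq_tabloid_vec; rewrite mulgA word_mul eqw -word_mul.
rewrite odd_permM odd_tperm neq_xy /=; congr (_ && _).
apply/column_stabilizerP/column_stabilizerP => Cs z.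
  by have := Cs (tau z); rewrite permM tpermK Ctau.
by rewrite permM Cs Ctau.
Qed.

(** With kappa the signed sum of the column stabilizer, e is the standard tabloid
    times kappa, so e *m f is the image of that tabloid by f, times kappa; and
    M^mu kappa is the line of e. *)
Lemma polytabloid_scalar f :
    intertwines (young_perm_repr k r mu) (young_perm_repr k r mu) f ->
  exists c, e *m f = c *: e.
Proof.
move=> homf.
pose kappa := \sum_(s in C) (-1) ^+ odd_perm s *: young_perm_mx k mu s.
have tvK t : tv t *m kappa = \sum_(s in C) (-1) ^+ odd_perm s *: tv (t * s)%g.
  rewrite mulmx_sumr; apply: eq_bigr => s _.
  by rewrite -scalemxAr tabloid_vec_act.
have -> : e *m f = (tv 1%g *m f) *m kappa.
  rewrite polytabloid1E mulmx_suml mulmx_sumr; apply: eq_bigr => s _.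
  rewrite -scalemxAl -scalemxAr -mulmxA -homf ?in_setT // mulmxA.
  by rewrite tabloid_vec_act mul1g.
have {}tvK i : exists c, delta_mx 0 i *m kappa = c *: e :> 'rV_#|tabloids r mu|.
  have [t Di] := index_word_in sum_mu size_mu i.
  rewrite -(tabloid_vec_delta Di) tvK; exact: column_antisymmetrizer.
have [c cP] := choice tvK.
exists (\sum_i (tv 1%g *m f) 0 i * c i); rewrite [_ *m f in LHS]row_sum_delta.
rewrite mulmx_suml scaler_suml; apply: eq_bigr => i _.
by rewrite -scalemxAl cP scalerA.
Qed.

End Polytabloid.

(** * The bilinear form of the polytabloid *)

Section PolytabloidForm.

Variables (k : fieldType) (r n : nat) (mu la : seq nat).
Hypotheses (sum_mu : sumn mu = r) (size_mu : (size mu <= n.+1)%N).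
Hypotheses (sum_la : sumn la = r) (size_la : (size la <= n.+1)%N).

Local Notation jtype := {ffun 'I_n.+1 * 'I_n.+1 -> nat}.
Local Notation e := (@polytabloid k r mu 1%g).

(** The bilinear form on homomorphisms M^mu -> M^la and M^la -> M^mu given by the
    eigenvalue of the composite on the polytabloid, in the coordinates of
    schur_mx. Its rank is the dimension of the la-weight space of the simple
    polynomial representation of highest weight mu. *)
Definition polytabloid_form (alpha beta : jtype -> k) : k :=
  \sum_(s in column_stabilizer mu (1%g : 'S_r)) \sum_(w in words r n la)
    (-1) ^+ odd_perm s
    * (alpha (joint (word n mu s) w) * beta (joint w (word n mu 1%g))).

Lemma tabloid_vec_schur_mx alpha t j :
  (tabloid_vec k mu t *m schur_mx r mu la alpha) 0 j
    = alpha (joint (word n mu t) (index_word n j)).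
Proof.
have [i Di] := index_of_word sum_mu size_mu t.
by rewrite (tabloid_vec_delta k sum_mu size_mu Di) -rowE !mxE Di.
Qed.

Lemma polytabloid_schur_mx alpha beta :
  e *m schur_mx r mu la alpha *m schur_mx r la mu beta
    = polytabloid_form alpha beta *: e.
Proof.
have [|c ec] := polytabloid_scalar sum_mu size_mu
  (f := schur_mx r mu la alpha *m schur_mx r la mu beta).
  have H1 := schur_mx_intertwines sum_mu size_mu sum_la size_la alpha.
  have H2 := schur_mx_intertwines sum_la size_la sum_mu size_mu beta.
  exact: intertwinesM H1 H2.
rewrite -mulmxA ec; congr (_ *: _).
have [i Di] := index_of_word sum_mu size_mu 1%g.
have := congr1 (fun v : 'rV_ _ => v 0 i) ec; rewrite [RHS]mxE.
rewrite (polytabloid_coef1 k sum_mu size_mu Di) mulr1 => <-.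
rewrite polytabloid1E mulmx_suml summxE; apply: eq_bigr => s _.
rewrite -scalemxAl mulmxA mxE mxE mulr_sumr.
rewrite -(big_index_word sum_la size_la (fun w => (-1) ^+ odd_perm s
    * (alpha (joint (word n mu s) w) * beta (joint w (word n mu 1%g))))).
apply: eq_bigr => j _; rewrite tabloid_vec_schur_mx.
by rewrite mxE Di.
Qed.

End PolytabloidForm.

(** * Fixed points of a permutation of order p *)

(** The other orbits of h have exactly p elements, on which F is constant, and
    so they contribute 0 in characteristic p. *)
Lemma sum_fixed_points (p : nat) (k : fieldType) (T : finType) (h : T -> T)
    (A : {pred T}) (F : T -> k) :
    prime p -> p \in [pchar k] -> (forall x, iter p h x = x) ->
    {in A, forall x, h x \in A} -> {in A, forall x, F (h x) = F x} ->
  \sum_(x in A) F x = \sum_(x in A | h x == x) F x.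
Proof.
move=> p_pr pk hp hA hF.
have inj_h : injective h.
  move=> x y eq_h; rewrite -(hp x) -(hp y).
  by rewrite -(prednK (prime_gt0 p_pr)) !iterSr eq_h.
pose H := perm inj_h.
have HX m x : (H ^+ m)%g x = iter m h x.
  by elim: m => [|m IH]; rewrite ?perm1 // expgSr permM IH permE.
have ordH : (#[H]%g %| p)%N.
  by rewrite order_dvdn; apply/eqP/permP => x; rewrite HX hp perm1.
have iterA m x : x \in A -> iter m h x \in A /\ F (iter m h x) = F x.
  by move=> Ax; elim: m => //= m [Am Fm]; rewrite hA // hF.
rewrite [LHS](bigID (fun x => h x == x)) /= [X in _ + X](_ : _ = 0) ?addr0 //.
rewrite (partition_big (porbit H) predT) //= big1 // => O _.
have [x /andP[/andP[Ax nfix] /eqP OX]|none] :=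
  pickP (fun x => (x \in A) && (h x != x) && (porbit H x == O)); last first.
  by rewrite big_pred0.
have orbO y : (y \in A) && (h y != y) && (porbit H y == O) = (y \in O).
  rewrite -OX eq_porbit_mem andb_idl // => /porbitP[m ->]; rewrite HX.
  have [-> _] := iterA m x Ax; rewrite -iterS iterSr.
  by rewrite -!HX (inj_eq perm_inj).
rewrite (eq_bigl _ _ orbO) (eq_bigr (fun=> F x)) => [|y]; last first.
  by rewrite -OX => /porbitP[m ->]; rewrite HX; have [] := iterA m x Ax.
rewrite sumr_const -OX.
have : (#|porbit H x| %| p)%N.
  by apply: dvdn_trans ordH; rewrite porbitE; apply: dvdn_orbit.
case/primeP: (p_pr) => _ dvdp /dvdp/orP[/eqP cO|/eqP->]; last first.
  by rewrite -mulr_natr (pcharf0 pk) mulr0.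
have : h x \in porbit H x by have := mem_porbit H 1 x; rewrite HX.
have /eqP/cards1P[z Ez] := cO; have := porbit_id H x; rewrite Ez !inE.
by move=> /eqP <-; rewrite (negPf nfix).
Qed.

(** * Inflating tableaux by p *)

Lemma reshape_index_cons l sh i :
  reshape_index (l :: sh) i
    = (if (i < l)%N then 0 else (reshape_index sh (i - l)).+1)%N.
Proof.
rewrite /reshape_index /= subn_eq0; case: ltnP => // le_li.
by rewrite subSn.
Qed.

(** Numbering boxes row after row makes the diagram of p mu the diagram of mu
    with each box x replaced by the p consecutive boxes p x, ..., p x + p - 1. *)
Lemma reshape_index_scale p mu i : (0 < p)%N ->
  reshape_index (scale_part p mu) i = reshape_index mu (i %/ p).
Proof.
move=> p_gt0; elim: mu i => //= l mu IH i; rewrite !reshape_index_cons.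
rewrite ltn_divLR // mulnC; case: ltnP => // le_i.
rewrite IH; congr (reshape_index _ _).+1.
by rewrite divnBMl.
Qed.

Lemma sumn_scale_partE p mu : sumn (scale_part p mu) = (p * sumn mu)%N.
Proof. by elim: mu => /= [|l mu ->]; rewrite ?muln0 // mulnDr. Qed.

Lemma reshape_offset_scale p mu i : (0 < p)%N ->
  reshape_offset (scale_part p mu) i
    = (p * reshape_offset mu (i %/ p) + i %% p)%N.
Proof.
move=> p_gt0; rewrite /reshape_offset reshape_index_scale // -map_take.
rewrite -/(scale_part _ _) sumn_scale_partE mulnBr addnC addnBA; last first.
  by rewrite leq_pmul2l // -[leqRHS](reshape_indexK mu) leq_addr.
by rewrite (addnC (i %% p)%N) (mulnC p (i %/ p)%N) -divn_eq.
Qed.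

Section Inflation.

Variables (p r n : nat).
Hypothesis p_prime : prime p.
Let p_gt0 := prime_gt0 p_prime.

Lemma block_lt (b : 'I_(p * r)) : (b %/ p < r)%N.
Proof. by rewrite ltn_divLR // [X in (_ < X)%N]mulnC. Qed.
Definition block (b : 'I_(p * r)) : 'I_r := Ordinal (block_lt b).

Lemma residue_lt (b : 'I_(p * r)) : (b %% p < p)%N.
Proof. by rewrite ltn_mod. Qed.
Definition residue (b : 'I_(p * r)) : 'I_p := Ordinal (residue_lt b).

Lemma subbox_lt (x : 'I_r) (d : 'I_p) : (p * x + d < p * r)%N.
Proof.
apply: (@leq_trans (p * x.+1)%N); first by rewrite mulnS addnC ltn_add2r.
by rewrite leq_pmul2l.
Qed.
Definition subbox x d : 'I_(p * r) := Ordinal (subbox_lt x d).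

Lemma block_subbox x d : block (subbox x d) = x.
Proof. by apply: val_inj; rewrite /= mulnC divnMDl // divn_small ?addn0. Qed.

Lemma residue_subbox x d : residue (subbox x d) = d.
Proof. by apply: val_inj; rewrite /= mulnC modnMDl modn_small. Qed.

Lemma subboxK b : subbox (block b) (residue b) = b.
Proof. by apply: val_inj; rewrite /= mulnC -divn_eq. Qed.

Lemma subbox_inj b1 b2 :
  block b1 = block b2 -> residue b1 = residue b2 -> b1 = b2.
Proof. by move=> eqb eqr; rewrite -(subboxK b1) eqb eqr subboxK. Qed.

Definition inflate_fun (s : 'S_r) b := subbox (s (block b)) (residue b).
Lemma inflate_fun_inj s : injective (inflate_fun s).
Proof.
move=> b c eq_bc; have := congr1 residue eq_bc; have := congr1 block eq_bc.
rewrite /inflate_fun !block_subbox !residue_subbox => /perm_inj.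
exact: subbox_inj.
Qed.
Definition inflate s : 'S_(p * r) := perm (@inflate_fun_inj s).

Lemma block_inflate s b : block (inflate s b) = s (block b).
Proof. by rewrite permE block_subbox. Qed.
Lemma residue_inflate s b : residue (inflate s b) = residue b.
Proof. by rewrite permE residue_subbox. Qed.

Definition shift_fun b := subbox (block b) (ordS (residue b)).
Lemma shift_fun_inj : injective shift_fun.
Proof.
move=> b c eq_bc; have := congr1 residue eq_bc; have := congr1 block eq_bc.
rewrite /shift_fun !block_subbox !residue_subbox => eqb /ordS_inj.
exact: subbox_inj.
Qed.
(** This generates the group of order p whose fixed points, among the pairs of a
    column permutation and a word for p mu, are the inflated pairs for mu. *)
Definition shift : 'S_(p * r) := perm shift_fun_inj.

Lemma block_shift b : block (shift b) = block b.
Proof. by rewrite permE block_subbox. Qed.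
Lemma residue_shift b : residue (shift b) = ordS (residue b).
Proof. by rewrite permE residue_subbox. Qed.

Lemma block_shiftV b : block (shift^-1%g b) = block b.
Proof. by rewrite -[in RHS](permKV shift b) block_shift. Qed.

Lemma block_shiftX m b : block ((shift ^+ m)%g b) = block b.
Proof. by elim: m => [|m IH]; rewrite ?perm1 // expgSr permM block_shift. Qed.

Lemma residue_shiftX m b :
  residue ((shift ^+ m)%g b) = ((residue b + m) %% p)%N :> nat.
Proof.
elim: m => [|m IH]; first by rewrite perm1 addn0 modn_small.
rewrite expgSr permM residue_shift.
transitivity ((residue ((shift ^+ m)%g b)).+1 %% p)%N => //.
by rewrite IH -addn1 modnDml addn1 addnS.
Qed.

Lemma shiftXp : (shift ^+ p = 1)%g.
Proof.
apply/permP => b; rewrite perm1; apply: subbox_inj; first exact: block_shiftX.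
by apply: val_inj; rewrite [LHS]residue_shiftX modnDr modn_small.
Qed.

Definition residue0 : 'I_p := Ordinal p_gt0.

Lemma subbox_shiftX x (d : 'I_p) :
  subbox x d = (shift ^+ d)%g (subbox x residue0).
Proof.
apply: subbox_inj; first by rewrite block_shiftX !block_subbox.
by apply: val_inj; rewrite [RHS]residue_shiftX !residue_subbox add0n modn_small.
Qed.

Lemma card_block_preim (P : pred 'I_r) :
  #|[set b | P (block b)]| = (p * #|[set x | P x]|)%N.
Proof.
transitivity #|setX [set x | P x] [set: 'I_p]|; last first.
  by rewrite cardsX cardsT card_ord [RHS]mulnC.
rewrite -(card_imset _
  (_ : injective (fun xd : 'I_r * 'I_p => subbox xd.1 xd.2))).
  congr #|pred_of_set _|; apply/setP => b; rewrite inE.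
  apply/idP/imsetP => [Pb|[[x d] /setXP[/=]]].
    by exists (block b, residue b); rewrite ?subboxK // !inE Pb.
  by rewrite inE => Px _ ->; rewrite block_subbox.
move=> [x d] [y c] /= eq_b.
have := congr1 residue eq_b; have := congr1 block eq_b.
by rewrite !block_subbox !residue_subbox => -> ->.
Qed.

Section Sign.

(** The action of s on the boxes of residue d only; inflate s is the product of
    these p commuting copies of s, which gives its sign. *)
Definition inflate_at_fun (d : 'I_p) (s : 'S_r) b :=
  if residue b == d then inflate s b else b.
Lemma inflate_at_fun_inj d s : injective (inflate_at_fun d s).
Proof.
move=> b c; rewrite /inflate_at_fun.
case: eqP => [bd|bd]; case: eqP => [cd|cd] //.
- exact: perm_inj.
- by move=> eq_bc; case: cd; rewrite -eq_bc residue_inflate.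
- by move=> eq_bc; case: bd; rewrite eq_bc residue_inflate.
Qed.
Definition inflate_at d s : 'S_(p * r) := perm (@inflate_at_fun_inj d s).

Lemma odd_inflate_at d s : odd_perm (inflate_at d s) = odd_perm s.
Proof.
have [ts -> dts] := prod_tpermP s; elim: ts dts => [_|[x y] ts IH] /=.
  rewrite big_nil odd_perm1 -(odd_perm1 'I_(p * r)); congr odd_perm.
  apply/permP => b; rewrite permE perm1 /inflate_at_fun; case: eqP => // _.
  by rewrite permE /inflate_fun perm1 subboxK.
case/andP => /= neq_xy /IH {}IH; rewrite big_cons odd_mul_tperm neq_xy -IH.
set s' := (\prod_(_ <- _) _)%g.
have -> : inflate_at d (tperm x y * s')%g
    = (tperm (subbox x d) (subbox y d) * inflate_at d s')%g.
  apply/permP => b; rewrite permM !(permE (@inflate_at_fun_inj _ _)).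
  rewrite /inflate_at_fun.
  have inj_subbox : injective (subbox^~ d).
    by move=> z z' /(congr1 block); rewrite !block_subbox.
  have [bd|bd] := eqVneq (residue b) d.
    have -> : b = subbox (block b) d by rewrite -bd subboxK.
    rewrite -(inj_tperm _ _ _ inj_subbox) residue_subbox eqxx.
    rewrite !(permE (@inflate_fun_inj _)) /inflate_fun !block_subbox.
    by rewrite !residue_subbox permM.
  rewrite tpermD ?(negPf bd) //.
    by apply: contraNneq bd => <-; rewrite residue_subbox.
  by apply: contraNneq bd => <-; rewrite residue_subbox.
by rewrite odd_mul_tperm (inj_eq (can_inj (block_subbox^~ d))) neq_xy.
Qed.

Lemma inflate_prod s : inflate s = (\prod_(d : 'I_p) inflate_at d s)%g.
Proof.
apply/permP => b; have : uniq (index_enum 'I_p) by apply: index_enum_uniq.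
have : residue b \in index_enum 'I_p by rewrite mem_index_enum.
elim: (index_enum _) => //= d ds IH; rewrite inE => b_in /andP[nds uds].
rewrite big_cons permM (permE (@inflate_at_fun_inj _ _)) /inflate_at_fun.
have [bd|bd] := eqVneq (residue b) d; last first.
  by apply: IH => //; move: b_in; rewrite (negPf bd).
have : residue (inflate s b) \notin ds by rewrite residue_inflate bd.
elim: ds {IH b_in nds uds} (inflate s b) => [|c ds IH] b'.
  by rewrite big_nil perm1.
rewrite inE negb_or => /andP[b'c b'ds].
rewrite big_cons permM (permE (@inflate_at_fun_inj _ _)) /inflate_at_fun.
by rewrite (negPf b'c) -IH.
Qed.

(** The sign is the p-th power of that of s; in characteristic p the p-th power
    fixes both 1 and -1, also when p = 2. *)
Lemma sign_inflate (k : fieldType) s : p \in [pchar k] ->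
  (-1) ^+ odd_perm (inflate s) = (-1) ^+ odd_perm s :> k.
Proof.
move=> pk; transitivity (((-1) ^+ odd_perm s) ^+ p : k).
  rewrite inflate_prod -[p in RHS]card_ord -prodr_const.
  elim/big_ind2: _ => [|u _ v _ <- <-|d _]; first by rewrite odd_perm1.
    by rewrite odd_permM signr_addb.
  by rewrite odd_inflate_at.
have N1p : (-1) ^+ p = -1 :> k.
  by rewrite -(pFrobenius_autE pk) rmorphN rmorph1.
by case: odd_perm; rewrite ?expr1n.
Qed.

End Sign.

Variables (mu la : seq nat).
Hypotheses (sum_mu : sumn mu = r) (size_mu : (size mu <= n.+1)%N).
Hypotheses (sum_la : sumn la = r) (size_la : (size la <= n.+1)%N).

Local Notation pmu := (scale_part p mu).
Local Notation pla := (scale_part p la).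

Lemma sumn_scale_part (nu : seq nat) :
  sumn nu = r -> sumn (scale_part p nu) = (p * r)%N.
Proof. by rewrite sumn_scale_partE => ->. Qed.

Lemma size_scale_part (nu : seq nat) :
  (size nu <= n.+1 -> size (scale_part p nu) <= n.+1)%N.
Proof. by rewrite size_map. Qed.

Definition inflate_word (w : {ffun 'I_r -> 'I_n.+1}) :
  {ffun 'I_(p * r) -> 'I_n.+1} := [ffun b => w (block b)].

Lemma word_inflate nu s : sumn nu = r -> (size nu <= n.+1)%N ->
  word n (scale_part p nu) (inflate s) = inflate_word (word n nu s).
Proof.
move=> sum_nu size_nu; apply/ffunP => b; apply: val_inj.
rewrite /= (wordE (sumn_scale_part sum_nu) (size_scale_part size_nu)).
rewrite ffunE (wordE sum_nu size_nu).
rewrite reshape_index_scale // -[LHS]/(reshape_index nu (block _)).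
congr reshape_index.
by congr val; apply: (perm_inj (s := s)); rewrite -block_inflate !permKV.
Qed.

Definition scale_joint (J : {ffun 'I_n.+1 * 'I_n.+1 -> nat}) :
  {ffun 'I_n.+1 * 'I_n.+1 -> nat} := [ffun ia => (p * J ia)%N].

Lemma joint_inflate w1 w2 :
  joint (inflate_word w1) (inflate_word w2) = scale_joint (joint w1 w2).
Proof.
apply/ffunP => ia; rewrite !ffunE -card_block_preim.
by congr #|pred_of_set _|; apply/setP => b; rewrite !inE !ffunE.
Qed.

Lemma word_shift s : word n pmu (shift^-1 * s)%g = word n pmu s.
Proof.
apply/ffunP => b; apply: val_inj.
rewrite /= !(wordE (sumn_scale_part sum_mu) (size_scale_part size_mu)).
rewrite invMg invgK permM !reshape_index_scale //.
by congr reshape_index; apply: (congr1 val (block_shift _)).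
Qed.

Lemma word1_shift :
  word_act (word n pmu (1 : 'S_(p * r))%g) shift = word n pmu 1%g.
Proof. by rewrite -word_mul mul1g -[LHS]word_shift mulVg. Qed.

Lemma inflate1 : inflate 1%g = 1%g.
Proof. by apply/permP => b; rewrite permE /inflate_fun !perm1 subboxK. Qed.

Local Notation C := (column_stabilizer mu (1%g : 'S_r)).
Local Notation C' := (column_stabilizer pmu (1%g : 'S_(p * r))).

Lemma column_stabilizer_scaleP (s : 'S_(p * r)) :
  reflect (forall b, reshape_offset mu (block (s b)) = reshape_offset mu (block b)
                  /\ residue (s b) = residue b) (s \in C').
Proof.
apply: (iffP (column_stabilizerP _ _)) => Cs b.
  have := Cs b; rewrite !reshape_offset_scale // => eq_off.
  have eqr : (s b %% p = b %% p)%N.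
    have mD a c : ((p * a + c) %% p = c %% p)%N by rewrite mulnC modnMDl.
    by have /= := congr1 (modn^~ p) eq_off; rewrite !mD !modn_mod.
  split; last exact: val_inj.
  by move: eq_off; rewrite eqr => /addIn/eqP; rewrite eqn_pmul2l // => /eqP.
rewrite !reshape_offset_scale //; have [/= eqc /(congr1 val) /= eqr] := Cs b.
by rewrite eqr eqc.
Qed.

Lemma conj_shift_column (s : 'S_(p * r)) : s \in C' -> (s ^ shift)%g \in C'.
Proof.
move/column_stabilizer_scaleP => Cs; apply/column_stabilizer_scaleP => b.
rewrite conjgE !permM block_shift residue_shift.
by have [-> ->] := Cs (shift^-1%g b); rewrite -residue_shift permKV block_shiftV.
Qed.

Lemma words_act nu g w :
  w \in words (p * r) n nu -> word_act w g \in words (p * r) n nu.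
Proof.
by case/imsetP => t _ ->; rewrite -word_mul; apply/imsetP; exists (t * g)%g.
Qed.

Definition shift_pair (sw : 'S_(p * r) * {ffun 'I_(p * r) -> 'I_n.+1}) :=
  ((sw.1 ^ shift)%g, word_act sw.2 shift).

Lemma iter_shift_pair m sw : iter m shift_pair sw
  = ((sw.1 ^ (shift ^+ m))%g, word_act sw.2 (shift ^+ m)%g).
Proof.
elim: m => [|m IH] /=.
  case: sw => s w; rewrite conjg1; congr (_, _).
  by apply/ffunP => b; rewrite ffunE invg1 perm1.
rewrite IH /shift_pair /= expgSr conjgM; congr (_, _).
by apply/ffunP => b; rewrite !ffunE invMg permM.
Qed.

Lemma inflate_column (s : 'S_r) : s \in C -> inflate s \in C'.
Proof.
move/column_stabilizerP => Cs; apply/column_stabilizer_scaleP => b.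
by rewrite block_inflate Cs residue_inflate.
Qed.

Lemma inflate_word_words w :
  w \in words r n la -> inflate_word w \in words (p * r) n pla.
Proof.
case/imsetP => t _ ->; rewrite -word_inflate //.
by apply/imsetP; exists (inflate t).
Qed.

Lemma inflate_fixed s w :
  shift_pair (inflate s, inflate_word w) = (inflate s, inflate_word w).
Proof.
congr (_, _); last by apply/ffunP => b; rewrite !ffunE block_shiftV.
apply/permP => b; rewrite conjgE !permM; apply: subbox_inj.
  by rewrite block_shift !block_inflate block_shiftV.
by rewrite residue_shift !residue_inflate -residue_shift permKV.
Qed.

(** Column stability forces s' to preserve residues, and commuting with the shift
    makes its effect on blocks independent of the residue. *)
Lemma fixed_column (s' : 'S_(p * r)) : s' \in C' -> (s' ^ shift)%g = s' ->
  exists2 s, s \in C & s' = inflate s.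
Proof.
move=> /column_stabilizer_scaleP Cs' fix_s'.
have comm m b : s' ((shift ^+ m)%g b) = (shift ^+ m)%g (s' b).
  have cs : commute s' shift by apply/commgP/conjg_fixP.
  by rewrite -!permM (commuteX m cs).
pose f x := block (s' (subbox x residue0)).
have s'E x d : s' (subbox x d) = subbox (f x) d.
  rewrite subbox_shiftX comm; apply: subbox_inj.
    by rewrite block_shiftX block_subbox.
  apply: val_inj; rewrite [LHS]residue_shiftX residue_subbox.
  have [_ ->] := Cs' (subbox x residue0).
  by rewrite residue_subbox add0n modn_small.
have inj_f : injective f.
  move=> x y eq_f.
  rewrite -(block_subbox x residue0) -(block_subbox y residue0); congr block.
  by apply: (perm_inj (s := s')); rewrite !s'E eq_f.
exists (perm inj_f).
  apply/column_stabilizerP => x; rewrite permE.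
  by have [] := Cs' (subbox x residue0); rewrite block_subbox.
apply/permP => b; rewrite -[in LHS](subboxK b) s'E.
by rewrite [RHS]permE /inflate_fun permE.
Qed.

(** A word constant on blocks comes from a word on 'I_r, whose letters have the
    right multiplicities because p times these are those of w'. *)
Lemma fixed_word w' : w' \in words (p * r) n pla -> word_act w' shift = w' ->
  exists2 w, w \in words r n la & w' = inflate_word w.
Proof.
move=> W' fix_w'; have inv_w' m b : w' ((shift ^+ m)%g b) = w' b.
  elim: m => [|m IH]; first by rewrite perm1.
  by rewrite expgSr permM -[in LHS]fix_w' ffunE permK.
have [w w'E] : exists w, w' = inflate_word w.
  exists [ffun x => w' (subbox x residue0)]; apply/ffunP => b.
  by rewrite !ffunE -[in LHS](subboxK b) subbox_shiftX inv_w'.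
exists w => //; have /imsetP[t' _ Dw'] := W'.
have [c|t tP] := @eq_fibers_perm r _ (word n la 1%g) w.
  apply/eqP; rewrite -(eqn_pmul2l p_gt0) -!card_block_preim.
  have -> : [set b | w (block b) == c] = [set b | w' b == c].
    by apply/setP => b; rewrite !inE w'E ffunE.
  have -> : [set b | word n la 1%g (block b) == c]
      = [set b | word n pla 1%g b == c].
    by apply/setP => b; rewrite !inE -inflate1 word_inflate // [in RHS]ffunE.
  rewrite -[X in X == _](card_preimset _ (@perm_inj _ t'^-1)) Dw'.
  apply/eqP; congr #|pred_of_set _|; apply/setP => b; rewrite !inE.
  by rewrite -[in RHS](mul1g t') word_mul [in RHS]ffunE.
apply/imsetP; exists t^-1%g => //; apply/ffunP => x.
by rewrite tP -[in RHS](mul1g t^-1%g) word_mul [in RHS]ffunE invgK.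
Qed.

Lemma inflate_word_inj : injective inflate_word.
Proof.
move=> w1 w2 /ffunP eq_w; apply/ffunP => x.
by have := eq_w (subbox x residue0); rewrite !ffunE block_subbox.
Qed.

Lemma inflate_inj : injective inflate.
Proof.
move=> s1 s2 /permP eq_s; apply/permP => x.
have := congr1 block (eq_s (subbox x residue0)).
by rewrite !block_inflate block_subbox.
Qed.

(** The Gram matrix of the form for (p mu, p la) is the one for (mu, la) on the
    joint matrices divisible by p, and 0 elsewhere. Simultaneous conjugation and
    translation by the shift preserve the summand attached to (s, w), since the
    shift preserves the rows of p mu; the pairs that it fixes are the inflated
    ones, for which joint matrices are multiplied by p. *)
Lemma polytabloid_form_scale (k : fieldType) alpha beta : p \in [pchar k] ->
  polytabloid_form (k := k) (p * r) pmu pla alpha beta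
    = polytabloid_form r mu la (alpha \o scale_joint) (beta \o scale_joint).
Proof.
move=> pk; rewrite /polytabloid_form !pair_big /=.
pose A' := [pred sw : 'S_(p * r) * {ffun 'I_(p * r) -> 'I_n.+1} |
  (sw.1 \in C') && (sw.2 \in words (p * r) n pla)].
rewrite (sum_fixed_points (h := shift_pair) (A := A') p_prime pk) /=.
- pose A := [pred sw : 'S_r * {ffun 'I_r -> 'I_n.+1} |
    (sw.1 \in C) && (sw.2 \in words r n la)].
  pose phi (sw : 'S_r * {ffun 'I_r -> 'I_n.+1}) :=
    (inflate sw.1, inflate_word sw.2).
  rewrite (eq_bigl (fun sw => sw \in phi @: A)) => [|[s' w'] /=].
    rewrite big_imset /=; last first.
      by move=> [s1 w1] [s2 w2] _ _ [/inflate_inj-> /inflate_word_inj->].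
    apply: eq_bigr => [[s w] _] /=.
    rewrite sign_inflate // -[in LHS]inflate1 !word_inflate //.
    by rewrite !joint_inflate.
  apply/andP/imsetP => [[/andP[/= C's W'w] /eqP[fixs fixw]]
                       |[[s w] /andP[/= Cs Ww] [-> ->]]].
    have [s Cs ->] := fixed_column C's fixs.
    have [w Ww ->] := fixed_word W'w fixw.
    by exists (s, w) => //; rewrite inE /= Cs.
  rewrite inflate_fixed eqxx; split => //; apply/andP.
  by rewrite /= inflate_column ?inflate_word_words.
- move=> sw; rewrite iter_shift_pair shiftXp conjg1; case: sw => s w; congr (_, _).
  by apply/ffunP => b; rewrite ffunE invg1 perm1.
- by move=> [s w] /andP[/= C's W'w]; rewrite inE /= conj_shift_column ?words_act.
move=> [s w] /andP[/= C's W'w]; rewrite odd_permJ.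
rewrite conjgE mulgA word_mul word_shift joint_act; congr (_ * (_ * beta _)).
by rewrite -[in LHS]word1_shift joint_act.
Qed.

End Inflation.

(** * Multiplicities of Young modules *)

(** The parts being positive, 'I_r.+1 has a letter for each row. *)
Lemma size_intpart r la : is_intpart r la -> sumn la = r /\ (size la <= r.+1)%N.
Proof.
case/and3P => _ n0 /eqP sum_la; split=> //; rewrite -sum_la.
elim: la n0 {sum_la} => //= l la IH; rewrite inE negb_or => /andP[l0 /IH le].
by rewrite -add1n -addnS leq_add // lt0n eq_sym.
Qed.

Section MultiplicityForm.

Variables (k : fieldType) (r n : nat) (mu la : seq nat).
Hypotheses (sum_mu : sumn mu = r) (size_mu : (size mu <= n.+1)%N).
Hypotheses (sum_la : sumn la = r) (size_la : (size la <= n.+1)%N).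
Variables (D : indec_decomposition (young_perm_repr k r la)) (m : nat)
  (rY : mx_representation k [set: 'S_r] m).
Hypothesis Y_young : is_young_module mu rY.

Local Notation jtype := {ffun 'I_n.+1 * 'I_n.+1 -> nat}.

(** The polytabloid lies in the Specht module, hence in the summand isomorphic to
    the Young module, so the preceding theory applies with e := polytabloid. *)
Lemma leq_multiplicityP d :
  (exists (alpha beta : 'I_d -> jtype -> k), forall i j,
     polytabloid_form r mu la (alpha i) (beta j) = (i == j)%:R)
  <-> (d <= multiplicity D rY)%N.
Proof.
have [D0 [i0 [sp_in Y_sim]]] := Y_young.
have e_in := submx_trans
  (cyclic_mx_id (young_perm_repr k r mu) (polytabloid k mu 1%g)) sp_in.
have nz_e := polytabloid_neq0 k sum_mu size_mu.
have scal := polytabloid_scalar (k := k) sum_mu size_mu.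
split=> [[alpha [beta dual]]|le_d].
  have dual_fh : dual_families (young_perm_repr k r mu) (young_perm_repr k r la)
      (polytabloid k mu 1%g) (fun i => schur_mx r mu la (alpha i))
      (fun j => schur_mx r la mu (beta j)).
    split=> [i|j|i j].
    - exact: (schur_mx_intertwines sum_mu size_mu sum_la size_la (alpha i)).
    - exact: (schur_mx_intertwines sum_la size_la sum_mu size_mu (beta j)).
    - by rewrite (polytabloid_schur_mx sum_mu size_mu sum_la size_la) dual.
  exact: (multiplicity_of_dual_families D nz_e scal e_in Y_sim dual_fh).
have [f [h [homf homh fh]]] := dual_families_of_multiplicity D e_in Y_sim.
have [alpha alphaP] := choice (fun i =>
  intertwines_schur_mx sum_mu size_mu sum_la size_la (homf i)).
have [beta betaP] := choice (fun j =>
  intertwines_schur_mx sum_la size_la sum_mu size_mu (homh j)).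
exists (alpha \o widen_ord le_d), (beta \o widen_ord le_d) => i j /=.
apply/eqP; have := fh (widen_ord le_d i) (widen_ord le_d j).
rewrite alphaP betaP (polytabloid_schur_mx sum_mu size_mu sum_la size_la).
move/eqP; rewrite -subr_eq0 -scalerBl scaler_eq0 (negPf nz_e) orbF subr_eq0.
by rewrite -val_eqE.
Qed.

End MultiplicityForm.

Local Close Scope ring_scope.

(* [M^{p la} : Y^{p mu}] = [M^la : Y^mu], whatever decompositions D', D of
   M^{p la}, M^la and whatever representatives rY', rY of Y^{p mu}, Y^mu are
   used to compute the two multiplicities. *)
Theorem theorem1 (p : nat) (k : fieldType) (r : nat) (la mu : seq nat)
    (p_prime : prime p) (char_k : p \in [pchar k]%R) (r_gt0 : 0 < r)
    (la_part : is_intpart r la) (mu_part : is_intpart r mu)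
    (D' : indec_decomposition (young_perm_repr k (p * r) (scale_part p la)))
    (D : indec_decomposition (young_perm_repr k r la))
    (m' : nat) (rY' : mx_representation k [set: 'S_(p * r)] m')
    (m : nat) (rY : mx_representation k [set: 'S_r] m)
    (Y'_young : is_young_module (scale_part p mu) rY')
    (Y_young : is_young_module mu rY) :
  multiplicity D' rY' = multiplicity D rY.
Proof.
have [sum_la size_la] := size_intpart la_part.
have [sum_mu size_mu] := size_intpart mu_part.
have P' := leq_multiplicityP (sumn_scale_part p sum_mu) (size_scale_part p size_mu)
  (sumn_scale_part p sum_la) (size_scale_part p size_la) D' Y'_young.
have P := leq_multiplicityP sum_mu size_mu sum_la size_la D Y_young.
apply/eqP; rewrite eqn_leq; apply/andP; split.
  have [alpha [beta dual]] := (P' _).2 (leqnn _).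
  apply/P; exists (fun i => alpha i \o @scale_joint p r).
  exists (fun j => beta j \o @scale_joint p r).
  by move=> i j; rewrite -polytabloid_form_scale.
have [alpha [beta dual]] := (P _).2 (leqnn _).
(* Only the values of alpha i \o div at the multiples of p matter, because
   the Gram matrix for p mu vanishes elsewhere. *)
pose div (J : {ffun 'I_r.+1 * 'I_r.+1 -> nat}) := [ffun ia => J ia %/ p]%N.
have divK a : (a \o div) \o @scale_joint p r = a :> (_ -> k).
  apply/funext => J /=; congr a; apply/ffunP => ia.
  by rewrite !ffunE mulKn ?prime_gt0.
apply/P'; exists (fun i => alpha i \o div), (fun j => beta j \o div) => i j.
by rewrite polytabloid_form_scale // !divK.
Qed.
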